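(* Let $F:\mathcal K\to L^2(\Omega)$ be Lipschitz and pointwise linearly bounded. Let $\mathbf m_n\in\mathbb M^{N_n}$ be a sequence such that for every $K\in\mathcal K$ there exist $K_n\in\mathcal K_{\mathbf m_n}$ with $K_n\to K$ in $L^2(\Omega)$. Let $X_n\in\mathrm{Lip}_{\rm loc}([0,\infty);\mathcal K_{\mathbf m_n})$ be discrete Lagrangian solutions corresponding to initial data $(\bar X_n,\bar V_n)\in\mathcal K_{\mathbf m_n}\times\mathcal H_{\mathbf m_n}$ that converge strongly in $L^2(\Omega)\times L^2(\Omega)$ to $(\bar X,\bar V)\in\mathcal K\times L^2(\Omega)$. Then $X_n\to X$ locally uniformly in $C([0,\infty);L^2(\Omega))$, where $X$ is the unique Lagrangian solution with initial data $(\bar X,\bar V)$.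
   Context: $\Omega=(0,1)$. $\mathcal K\subset L^2(\Omega)$ is the closed convex cone of nondecreasing functions. For a closed convex set $C\subset L^2(\Omega)$ and $X\in C$, $\partial I_C(X)=\{W\in L^2(\Omega):\int_\Omega W(\tilde X-X)\,dm\le0\ \forall\tilde X\in C\}$. $\mathbb M^N:=\{\mathbf m=(m_1,\dots,m_N)\in\mathbb R^N: m_i>0,\ \sum_im_i=1\}$. Given $\mathbf m\in\mathbb M^N$, set $w_0=0$, $w_i=\sum_{j=1}^im_j$, $W_i=[w_{i-1},w_i)$, and $$\mathcal H_{\mathbf m}:=\Big\{\sum_{i=1}^Nx_i\mathbf 1_{W_i}:x\in\mathbb R^N\Big\},\qquad \mathcal K_{\mathbf m}:=\Big\{\sum_{i=1}^Nx_i\mathbf 1_{W_i}:x_1\le x_2\le\dots\le x_N\Big\}\subset\mathcal K.$$ With $\mathsf P_{\mathcal H_{\mathbf m}}$ the orthogonal projection of $L^2(\Omega)$ onto $\mathcal H_{\mathbf m}$, put $F_{\mathbf m}[X]:=\mathsf P_{\mathcal H_{\mathbf m}}(F[X])$. A discrete Lagrangian solution (for $\mathbf m$) with initial data $(\bar X,\bar V)\in\mathcal K_{\mathbf m}\times\mathcal H_{\mathbf m}$ is a curve $X\in\mathrm{Lip}_{\rm loc}([0,\infty);\mathcal K_{\mathbf m})$ with $X(0)=\bar X$ and $\dot X(t)+\partial I_{\mathcal K_{\mathbf m}}(X(t))\ni\bar V+\int_0^tF_{\mathbf m}[X(s)]\,ds$ for a.e. $t>0$. A Lagrangian solution with initial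 data $(\bar X,\bar V)\in\mathcal K\times L^2(\Omega)$ is a curve $X\in\mathrm{Lip}_{\rm loc}([0,\infty);\mathcal K)$ with $X(0)=\bar X$ and $\dot X(t)+\partial I_{\mathcal K}(X(t))\ni\bar V+\int_0^tF[X(s)]\,ds$ for a.e. $t>0$; it exists and is unique when $F$ is Lipschitz. $F$ is Lipschitz if $\|F[X_1]-F[X_2]\|_{L^2(\Omega)}\le L\|X_1-X_2\|_{L^2(\Omega)}$ for all $X_1,X_2\in\mathcal K$ and some $L\ge0$; pointwise linearly bounded if there is $C_{\mathsf p}\ge0$ with $|F[X](m)|\le C_{\mathsf p}(1+|X(m)|+\|X\|_{L^1(\Omega)})$ for a.e. $m\in\Omega$ and all $X\in\mathcal K$. *)

(* Defs.v *)
From HB Require Import structures.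
From mathcomp Require Import all_boot all_order all_algebra.
From mathcomp Require Import all_classical all_reals all_analysis.
Set Implicit Arguments.
Unset Strict Implicit.
Unset Printing Implicit Defensive.
Import Order.TTheory GRing.Theory Num.Theory.
Import numFieldNormedType.Exports.

Local Open Scope classical_set_scope.
Local Open Scope ring_scope.

Definition Omega (R : realType) : set R := `]0, 1[.
Arguments Omega : clear implicits.

Lemma measurable_Omega (R : realType) : measurable (Omega R).
Proof. exact: measurable_itv. Qed.

(* Lebesgue measure restricted to Omega, as a measure on the whole of R *)
Definition mOmega (R : realType) : {measure set (measurableTypeR R) -> \bar R} :=
  mrestr (@lebesgue_measure R) (@measurable_Omega R).
Arguments mOmega : clear implicits.

Definition one_le_two (R : realType) : (1%E <= 2%:E :> \bar R)%E := lee1n 2.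

(* Elements of L^2(Omega) are represented by square-integrable functions and
   are compared up to [mOmega]-null sets (values outside Omega are irrelevant).
   The library's quotient [LspaceType] carries no vector space structure. *)
Definition L2 (R : realType) : lmodType R := LfunType (mOmega R) (one_le_two R).

Section L2.
Context {R : realType}.
Local Notation L2 := (L2 R).
Local Notation mOmega := (mOmega R).

Definition L2norm (X : L2) : R := fine ('N[mOmega]_2%:E[EFin \o (X : R -> R)])%E.

Definition L1norm (X : L2) : R := fine ('N[mOmega]_1[EFin \o (X : R -> R)])%E.

Definition L2inner (X Y : L2) : R := \int[mOmega]_u (X u * Y u).

Definition L2eq (X Y : L2) : Prop := X = Y %[ae mOmega].

Definition L2cvg (Xn : nat -> L2) (X : L2) : Prop :=
  L2norm (Xn n - X) @[n --> \oo] --> 0.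

Definition K : set L2 := [set X | exists2 g : R -> R,
  {in Omega R &, {homo g : u v / u <= v}} & X = g %[ae mOmega]].

Definition subdiff (C : set L2) (X : L2) : set L2 :=
  [set W | forall Y, C Y -> L2inner W (Y - X) <= 0].

Section discrete.
Context {N : nat} (m : 'I_N -> R).

Definition simplex : Prop := (forall i, 0 < m i) /\ \sum_i m i = 1.

Definition w (k : nat) : R := \sum_(j < N | (j < k)%N) m j.

(* 0-based: [W i] is the (i+1)-st interval of the partition *)
Definition W (i : 'I_N) : set R := `[w i, w i.+1[.

Definition step_fun (x : 'I_N -> R) (u : R) : R := \sum_i x i * \1_(W i) u.

Definition Hm : set L2 :=
  [set X | exists x : 'I_N -> R, X = step_fun x %[ae mOmega]].

Definition Km : set L2 := [set X | exists2 x : 'I_N -> R,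
  {homo x : i j / (i <= j)%N >-> i <= j} & X = step_fun x %[ae mOmega]].

End discrete.

(* Orthogonal projection onto a subspace. It is unique only up to null sets;
   [xget] picks a representative. *)
Definition orth_proj (H : set L2) (Z : L2) : L2 :=
  xget 0 [set Y | H Y /\ forall Z', H Z' -> L2inner (Z - Y) Z' = 0].

Definition Fm {N : nat} (m : 'I_N -> R) (F : L2 -> L2) (X : L2) : L2 :=
  orth_proj (Hm m) (F X).

Record simple_curve := SimpleCurve {
  pieces : nat;
  piece : 'I_pieces -> set R;
  measurable_piece : forall i, measurable (piece i);
  value : 'I_pieces -> L2 }.

Definition simple_curve_fun (g : simple_curve) (s : R) : L2 :=
  \sum_i \1_(@piece g i) s *: value i.

Definition simple_curve_integral (D : set R) (g : simple_curve) : L2 :=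
  \sum_i fine (lebesgue_measure (@piece g i `&` D)) *: value i.

(* [Y] is the Bochner integral of [G] over the bounded set [D]:
   [G] is strongly measurable and Bochner integrable on [D]. *)
Definition is_bochner_integral (D : set R) (G : R -> L2) (Y : L2) : Prop :=
  exists g : nat -> simple_curve,
  [/\ {ae lebesgue_measure, forall s, D s ->
         L2cvg (fun k => simple_curve_fun (g k) s) (G s)},
      (\int[lebesgue_measure]_(s in D)
         (L2norm (simple_curve_fun (g k) s - G s))%:E @[k --> \oo] --> 0)%E &
      L2cvg (fun k => simple_curve_integral D (g k)) Y].

(* Curves [0, oo) -> L^2 are functions on R whose values at negative times are
   irrelevant. *)
Definition Lip_loc (C : set L2) (X : R -> L2) : Prop :=
  (forall t, 0 <= t -> C (X t)) /\
  forall T, 0 <= T -> exists L, forall s t, 0 <= s <= T -> 0 <= t <= T ->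
    L2norm (X t - X s) <= L * `|t - s|.

Definition has_derivative (X : R -> L2) (t : R) (D : L2) : Prop :=
  L2norm (h^-1 *: (X (t + h) - X t) - D) @[h --> 0^'] --> 0.

(* X' + subdiff C X \ni Vbar + \int_0^t G[X(s)] ds for a.e. t > 0 *)
Definition solution (C : set L2) (G : L2 -> L2) (Xbar Vbar : L2)
    (X : R -> L2) : Prop :=
  [/\ Lip_loc C X,
      L2eq (X 0) Xbar &
      {ae lebesgue_measure, forall t, 0 < t -> exists Xdot Y : L2,
        [/\ has_derivative X t Xdot,
            is_bochner_integral `[0, t] (G \o X) Y &
            subdiff C (X t) (Vbar + Y - Xdot)]}].

Definition lagrangian_solution (F : L2 -> L2) : L2 -> L2 -> (R -> L2) -> Prop :=
  solution K F.

Definition discrete_lagrangian_solution {N : nat} (m : 'I_N -> R)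
    (F : L2 -> L2) : L2 -> L2 -> (R -> L2) -> Prop :=
  solution (Km m) (Fm m F).

(* A force [F : K -> L^2] is a total map of which only the values on [K] are
   constrained. Being Lipschitz, it respects a.e. equality on [K]. *)
Definition force_lipschitz (F : L2 -> L2) : Prop :=
  exists2 L : R, 0 <= L & forall X1 X2, K X1 -> K X2 ->
    L2norm (F X1 - F X2) <= L * L2norm (X1 - X2).

Definition pointwise_linearly_bounded (F : L2 -> L2) : Prop :=
  exists2 Cp : R, 0 <= Cp & forall X, K X ->
    {ae mOmega, forall u, `|F X u| <= Cp * (1 + `|X u| + L1norm X)}.

End L2.

(* Main.v *)
Require Import Defs.
From mathcomp Require Import all_boot all_order all_algebra.
From mathcomp Require Import all_classical all_reals all_analysis.
From mathcomp Require Import measurable_realfun.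
From mathcomp Require Import ring lra.
Set Implicit Arguments.
Unset Strict Implicit.
Unset Printing Implicit Defensive.
Import Order.TTheory GRing.Theory Num.Theory.
Import numFieldNormedType.Exports.
Local Open Scope classical_set_scope.
Local Open Scope ring_scope.

(** Both assertions follow from one stability estimate ([stability]), which
compares an exact solution X2 on the cone K with a solution X1 of the same
inclusion on a subset C of K driven by a Galerkin-type force G, one that
cannot be told from F when tested on differences of elements of C
([galerkin]).  Uniqueness is the case C = K, G = F; convergence is the case
C = K_m, G = F_m.

Write W1, W2 for the elements of the two normal cones picked out by the
inclusions, V1, V2 for the initial velocities, Y1, Y2 for the integrated
forces.  Then X1' - X2' = (V1 - V2) + (Y1 - Y2) - W1 + W2, and this is paired
with X1 - X2.  As C lies in K, the curve X1 is an admissible competitor for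
W2, so the W2 term is nonpositive.  The converse fails, X2 being outside C in
general; but if Z in C is k-close to X2, testing W1 with Z makes the W1 term at
most k |W1|.  The same Z treats the projected force: on X1 - Z, a difference
of elements of C, the force G acts as F, which is Lipschitz, and the rest is
O(k).  All this needs a bound on W1 that does not depend on C.  It comes
from orthogonality: X1(t + h) and X1(t - h) are both competitors at time t, so
<W1, X1'> is both <= 0 and >= 0, and |X1'| <= |V1 + Y1|
([subdiff_velocity], [subdiff_velocity_le]).  The outcome is
[velocity_gap]: |X1 - X2|^2 grows at almost every time at a rate bounded by the
data errors plus a multiple of its past supremum, whence a Gronwall bound
([gronwall_sup]).

Three tools support this.  A Lipschitz function whose upper derivative is a.e.
nonpositive does not increase ([lipschitz_nonincreasing]); this lets
differential inequalities known only a.e. be integrated.  Bochner integrals of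
Lipschitz curves are reduced to scalar integrals of inner products
([bochner_inner]).  The projection onto step functions exists and is a
contraction ([orth_proj_ex], [orth_proj_contract]).

Finally k is made small uniformly on [0, T] by density of the cones K_m at
finitely many times, since X2 is Lipschitz in time
([uniform_approximation]). *)

(** * Hilbert space structure of L2 *)

Section Hilbert.
Context {R : realType}.
Implicit Types (X Y Z : L2 R) (a : R).
Local Notation mO := (mOmega R).

Lemma L2_add X Y u : (X + Y : L2 R) u = X u + Y u.
Proof. by []. Qed.

Lemma L2_opp X u : (- X : L2 R) u = - X u.
Proof. by []. Qed.

Lemma L2_scale a X u : (a *: X : L2 R) u = a * X u.
Proof. by []. Qed.

Definition L2E := (L2_add, L2_opp, L2_scale).

Lemma integrable_L2mul X Y : mO.-integrable setT (EFin \o (fun u => X u * Y u)).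
Proof.
by apply/Lfun1_integrable; apply: Lfun2_mul_Lfun1; exact: LfunP.
Qed.

Lemma L2innerC X Y : L2inner X Y = L2inner Y X.
Proof. by apply: eq_Rintegral => u _; rewrite mulrC. Qed.

Lemma L2innerDl X Y Z : L2inner (X + Y) Z = L2inner X Z + L2inner Y Z.
Proof.
rewrite /L2inner -RintegralD//; try exact: integrable_L2mul.
by apply: eq_Rintegral => u _; rewrite L2_add mulrDl.
Qed.

Lemma L2innerZl a X Z : L2inner (a *: X) Z = a * L2inner X Z.
Proof.
rewrite /L2inner -RintegralZl//; last exact: integrable_L2mul.
by apply: eq_Rintegral => u _; rewrite L2_scale mulrA.
Qed.

Lemma L2inner_ge0 X : 0 <= L2inner X X.
Proof. by apply: Rintegral_ge0 => u _; rewrite -expr2 sqr_ge0. Qed.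

Lemma L2norm_ge0 X : 0 <= L2norm X.
Proof. by rewrite /L2norm fine_ge0// Lnorm_ge0. Qed.

Lemma L2norm_sqr X : L2norm X ^+ 2 = L2inner X X.
Proof.
rewrite -powR_mulrn ?L2norm_ge0//.
apply: EFin_inj; rewrite -poweR_EFin finite_norm_fine poweR_Lnorm//.
rewrite /L2inner /Rintegral fineK; last first.
  by apply: integrable_fin_num => //; exact: integrable_L2mul.
apply: eq_integral => u _ /=.
by rewrite powR_mulrn// real_normK ?num_real// expr2.
Qed.

Lemma L2innerNl X Z : L2inner (- X) Z = - L2inner X Z.
Proof. by rewrite -scaleN1r L2innerZl mulN1r. Qed.

Lemma L2innerBl X Y Z : L2inner (X - Y) Z = L2inner X Z - L2inner Y Z.
Proof. by rewrite L2innerDl L2innerNl. Qed.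

Lemma L2inner0l Z : L2inner 0 Z = 0.
Proof. by rewrite -(subrr Z) L2innerBl subrr. Qed.

Lemma L2innerDr X Y Z : L2inner Z (X + Y) = L2inner Z X + L2inner Z Y.
Proof. by rewrite L2innerC L2innerDl !(L2innerC Z). Qed.

Lemma L2innerZr a X Z : L2inner Z (a *: X) = a * L2inner Z X.
Proof. by rewrite L2innerC L2innerZl !(L2innerC Z). Qed.

Lemma L2innerNr X Z : L2inner Z (- X) = - L2inner Z X.
Proof. by rewrite L2innerC L2innerNl !(L2innerC Z). Qed.

Lemma L2innerBr X Y Z : L2inner Z (X - Y) = L2inner Z X - L2inner Z Y.
Proof. by rewrite L2innerDr L2innerNr. Qed.

Lemma L2inner_suml n (v : 'I_n -> L2 R) Z :
  L2inner (\sum_i v i) Z = \sum_i L2inner (v i) Z.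
Proof.
elim/big_ind2 : _ => //; first exact: L2inner0l.
by move=> x1 x2 y1 y2 <- <-; rewrite L2innerDl.
Qed.

Lemma L2norm_le X (b : R) : 0 <= b -> L2norm X ^+ 2 <= b ^+ 2 -> L2norm X <= b.
Proof. by move=> b0; rewrite ler_pXn2r// nnegrE L2norm_ge0. Qed.

Lemma L2inner_sqr_le X Y : L2inner X Y ^+ 2 <= L2inner X X * L2inner Y Y.
Proof.
set p := L2inner X X; set q := L2inner X Y; set r := L2inner Y Y.
have r0 : 0 <= r by exact: L2inner_ge0.
(* Cauchy-Schwarz is read off the quadratic form |s X - t Y|^2: null
   vectors need not vanish, so Y of norm 0 is treated apart. *)
have quad s t : 0 <= s ^+ 2 * p - 2 * (s * t) * q + t ^+ 2 * r.
  have := L2inner_ge0 (s *: X - t *: Y).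
  rewrite !(L2innerBl, L2innerBr, L2innerZl, L2innerZr) (L2innerC Y X).
  by rewrite -/p -/q -/r; congr (_ <= _); ring.
have [r1|r1] := eqVneq r 0.
  (* on a null vector Y the quadratic form is affine in the coefficient of Y *)
  have [->|q0] := eqVneq q 0; first by rewrite expr0n/= mulr_ge0// L2inner_ge0.
  have := quad 1 ((p + 1) / (2 * q)).
  rewrite r1 (_ : _ + _ = -1); first by rewrite oppr_ge0 ler10.
  by field.
have := quad r q; rewrite (_ : _ + _ = r * (p * r - q ^+ 2)); last by ring.
by rewrite pmulr_rge0 ?subr_ge0// lt_def r1.
Qed.

Lemma L2_cauchy_schwarz X Y : `|L2inner X Y| <= L2norm X * L2norm Y.
Proof.
rewrite -ler_sqr ?nnegrE ?mulr_ge0 ?L2norm_ge0// real_normK ?num_real//.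
by rewrite exprMn !L2norm_sqr L2inner_sqr_le.
Qed.

Lemma L2inner_le X Y : L2inner X Y <= L2norm X * L2norm Y.
Proof. exact: le_trans (ler_norm _) (L2_cauchy_schwarz X Y). Qed.

Lemma L2normD X Y : L2norm (X + Y) <= L2norm X + L2norm Y.
Proof. exact: ler_LnormD. Qed.

Lemma L2normZ a X : L2norm (a *: X) = `|a| * L2norm X.
Proof.
apply/eqP; rewrite -(@eqrXn2 _ 2)// ?mulr_ge0 ?L2norm_ge0//.
by rewrite exprMn real_normK ?num_real// !L2norm_sqr L2innerZl L2innerZr mulrA.
Qed.

Lemma L2normN X : L2norm (- X) = L2norm X.
Proof. by rewrite -scaleN1r L2normZ normrN1 mul1r. Qed.

Lemma L2normC X Y : L2norm (X - Y) = L2norm (Y - X).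
Proof. by rewrite -L2normN opprB. Qed.

Lemma L2norm0 : L2norm (0 : L2 R) = 0.
Proof. by rewrite -(scale0r (0 : L2 R)) L2normZ normr0 mul0r. Qed.

Lemma L2normB X Y : L2norm (X - Y) <= L2norm X + L2norm Y.
Proof. by rewrite -(L2normN Y) L2normD. Qed.

Lemma L2norm_triangle X Y Z : L2norm (X - Z) <= L2norm (X - Y) + L2norm (Y - Z).
Proof.
have -> : X - Z = (X - Y) + (Y - Z) by rewrite addrA subrK.
exact: L2normD.
Qed.

Lemma L2norm_lip X Y : `|L2norm X - L2norm Y| <= L2norm (X - Y).
Proof.
have le (U V : L2 R) : L2norm U - L2norm V <= L2norm (U - V).
  by have := L2normD (U - V) V; rewrite subrK lerBlDr.
by rewrite ler_norml le andbT lerNl opprB L2normC le.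
Qed.

Lemma L2norm_eq0 X : L2norm X = 0 -> L2eq X 0.
Proof. exact: fine_Lnormr_eq0. Qed.

Lemma eq_L2inner X X' Y : L2eq X X' -> L2inner X Y = L2inner X' Y.
Proof.
move=> XX'; rewrite /L2inner /Rintegral; congr fine.
apply: ae_eq_integral => //.
- by have /integrableP[] := integrable_L2mul X Y.
- by have /integrableP[] := integrable_L2mul X' Y.
- by apply: filterS XX' => u /= /(_ I)/= -> _.
Qed.

Lemma L2norm_L2eq0 X Y : L2eq X Y -> L2norm (X - Y) = 0.
Proof.
move=> XY; apply/eqP; rewrite -sqrf_eq0 L2norm_sqr L2innerBl (eq_L2inner _ XY).
by rewrite subrr.
Qed.

End Hilbert.

(** * Growth of Lipschitz functions from a.e. derivative bounds *)

Section Growth.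
Context {R : realType}.
Implicit Types (f : R -> R) (a b c t : R).
Local Notation mu := (@lebesgue_measure R).

Lemma le_lebesgue (A B : set R) : measurable A -> measurable B -> A `<=` B ->
  (mu A <= mu B)%E.
Proof.
move=> mA mB AB.
apply: (@le_measure _ R (measurableTypeR R) (@lebesgue_measure R) _ _ _ _ AB).
  by apply: mem_set; exact: mA.
by apply: mem_set; exact: mB.
Qed.

Lemma null_open_cover (N : set R) (e : R) : mu.-negligible N -> 0 < e ->
  exists U : set R, [/\ open U, N `<=` U & (mu U < e%:E)%E].
Proof.
move=> [M [mM M0 NM]] e0.
have [|U [oU MU UM]] := lebesgue_regularity_outer mM _ e0.
  by rewrite [X in (X < _)%E]M0 ltry.
exists U; split => //; first exact: subset_trans MU.
have mU : measurable U by exact: open_measurable.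
rewrite -(setDUK MU); apply: le_lt_trans (measureU2 _ _ _) _ => //.
  exact: measurableD.
by rewrite [X in (X + _)%E]M0 add0e.
Qed.

(** A null set of bad times is covered by an open U of measure at most e. Along
U the function may grow at rate L, which costs at most L e in total; off U
it grows at rate at most e. Hence f t <= f a + L |U inter [a, t]| + e (t -
a) propagates from a to b by continuous induction. *)
Lemma lipschitz_nonincreasing f a b (Lf : R) : a <= b ->
  (forall s t, a <= s <= b -> a <= t <= b -> `|f t - f s| <= Lf * `|t - s|) ->
  {ae mu, forall t, a < t < b -> forall e : R, 0 < e ->
     exists2 d : R, 0 < d & forall h : R, 0 < h < d ->
       f (t + h) - f t <= e * h} ->
  f b <= f a.
Proof.
move=> ab fL fae.
have {}fL s t : a <= s <= b -> a <= t <= b ->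
    `|f t - f s| <= (`|Lf| + 1) * `|t - s|.
  move=> sab tab; apply: le_trans (fL s t sab tab) _.
  by rewrite ler_wpM2r// (le_trans (ler_norm _))// lerDl.
set L : R := `|Lf| + 1 in fL; have L0 : 0 < L by rewrite ltr_wpDl.
apply/ler_addgt0Pr => e1 e10.
pose e : R := e1 / (L + (b - a)).
have Lab : 0 < L + (b - a) by rewrite ltr_pwDl// subr_ge0.
have e0 : 0 < e by rewrite divr_gt0.
(* The point a, where no derivative bound is assumed, is put in U as well. *)
have [U [oU]] : exists U : set R, [/\ open U,
    ~` [set t | a < t < b -> forall e : R, 0 < e ->
     exists2 d : R, 0 < d & forall h : R, 0 < h < d -> f (t + h) - f t <= e * h]
     `|` [set a] `<=` U & (mu U < e%:E)%E].
  apply: null_open_cover => //; apply: negligibleU => //.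
  by apply/negligibleP => //; exact: lebesgue_measure_set1.
rewrite subUset => -[NU /(_ a erefl) aU] muU.
have mU : measurable U by exact: open_measurable.
have mUI t : measurable (U `&` `[a, t]) by exact: measurableI.
have Ufin t : mu (U `&` `[a, t]) \is a fin_num.
  rewrite ge0_fin_numE//; apply: (@le_lt_trans _ _ (mu U)).
    by apply: le_lebesgue => //; exact: subIsetl.
  exact: lt_trans muU (ltry _).
pose v t := fine (mu (U `&` `[a, t])).
have v_ge0 t : 0 <= v t by exact: fine_ge0.
have v_lt t : v t <= e.
  rewrite -lee_fin fineK//; apply: le_trans (ltW muU).
  by apply: le_lebesgue => //; exact: subIsetl.
have v_homo s t : s <= t -> v s <= v t.
  move=> st; rewrite fine_le//; apply: le_lebesgue => //; apply: setIS.
  by apply: subset_itvl; rewrite bnd_simp.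
(* The supremum of S belongs to S and cannot be smaller than b. *)
pose S : set R := [set t | a <= t <= b /\ f t <= f a + L * v t + e * (t - a)].
have Sa : S a by split; rewrite ?lexx//= subrr mulr0 addr0 lerDl mulr_ge0// ltW.
have ubS : ubound S b by move=> t [/andP[]].
have supS : has_sup S by split; [exists a|exists b].
set c := sup S.
have ac : a <= c by apply: sup_upper_bound.
have cb : c <= b by apply: ge_sup => //; exists a.
have Sc : S c.
  split; first by rewrite ac cb.
  apply/ler_addgt0Pr => d d0.
  have [t [/andP[at_ tb] ft] ct] := sup_adherent (divr_gt0 d0 L0) supS.
  have tc : t <= c by apply: sup_upper_bound => //; split; rewrite ?at_.
  have := fL t c; rewrite at_ tb ac cb => /(_ isT isT).
  rewrite ler_norml => /andP[_].
  rewrite (ger0_norm (_ : 0 <= c - t)) ?subr_ge0//.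
  have : L * (c - t) <= d by rewrite mulrC -ler_pdivlMr// lerBlDl -lerBlDr ltW.
  have := ler_wpM2l (ltW L0) (v_homo _ _ tc).
  have := ler_wpM2l (ltW e0) (lerB tc (lexx a)).
  lra.
suff cE : c = b.
  have [_] := Sc; rewrite cE => /le_trans -> //.
  rewrite -addrA lerD2l (@le_trans _ _ (e * (L + (b - a))))//.
    by have := ler_wpM2l (ltW L0) (v_lt b); lra.
  by rewrite /e divfK// gt_eqF.
apply/eqP/negPn/negP => cb'.
have {}cb' : c < b by rewrite lt_neqAle cb'.
suff [t ct St] : exists2 t, c < t & S t.
  by have := sup_upper_bound supS St; rewrite leNgt ct.
have [_ fc] := Sc.
have [Uc|Uc] := pselect (U c).
  have /nbhs_ballP[r /= r0 rU] : nbhs c U by exact: open_nbhs_nbhs.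
  pose h := Num.min (r / 2) (b - c).
  have h0 : 0 < h by rewrite lt_min divr_gt0// subr_gt0.
  have hr : h < r by rewrite gt_min ltr_pdivrMr// ltr_pMr// ltr1n.
  have hb : h <= b - c by rewrite ge_min lexx orbT.
  exists (c + h); first by rewrite ltrDl.
  split; first by lra.
  have vch : v c + h <= v (c + h).
    rewrite -lee_fin EFinD !fineK//.
    have -> : h%:E = mu `]c, c + h].
      by rewrite lebesgue_measure_itv/= lte_fin ltrDl h0 -EFinB addrC addKr.
    have mci : measurable (`]c, c + h] : set R) by exact: measurable_itv.
    apply: (@le_trans _ _ (mu ((U `&` `[a, c]) `|` `]c, c + h]))); last first.
      apply: le_lebesgue => //; first exact: measurableU.
      rewrite subUset; split.
        by apply: setIS; apply: subset_itvl; rewrite bnd_simp lerDl ltW.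
      move=> x /=; rewrite in_itv/= => /andP[cx xch]; split.
        by apply: rU; rewrite /ball/= ltr0_norm ?subr_lt0// opprB; lra.
      by rewrite in_itv/= xch andbT; lra.
    rewrite measureU; [by []|exact: mUI|exact: mci|].
    apply/seteqP; split => // x [[_ /=]]; rewrite !in_itv/=.
    by move=> /andP[_ xc] /andP[]; rewrite ltNge xc.
  have := fL c (c + h) ltac:(lra) ltac:(lra).
  rewrite ler_norml => /andP[_].
  rewrite (addrC c) addrK (gtr0_norm h0) (addrC h).
  have := ler_wpM2l (ltW L0) vch; have := mulr_ge0 (ltW e0) (ltW h0).
  by nra.
have ac' : a < c.
  by rewrite lt_neqAle ac andbT; apply/eqP => acE; apply: Uc; rewrite -acE.
have : a < c < b -> forall e : R, 0 < e ->
     exists2 d : R, 0 < d & forall h : R, 0 < h < d -> f (c + h) - f c <= e * h.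
  by apply: contrapT => Nc; apply/Uc/NU.
rewrite ac' cb' => /(_ isT _ e0)[d d0 fd].
pose h := Num.min (d / 2) (b - c).
have h0 : 0 < h by rewrite lt_min divr_gt0// subr_gt0.
have hd : h < d by rewrite gt_min ltr_pdivrMr// ltr_pMr// ltr1n.
have hb : h <= b - c by rewrite ge_min lexx orbT.
exists (c + h); first by rewrite ltrDl.
split; first by lra.
have := fd h; rewrite h0 hd => /(_ isT).
have := ler_wpM2l (ltW L0) (v_homo c (c + h) ltac:(lra)).
by nra.
Qed.


(** The upper right Dini derivative of f at t is at most D. *)
Definition upper_derivative_le f t (D : R) := forall e : R, 0 < e ->
  exists2 d : R, 0 < d & forall h : R, 0 < h < d ->
    f (t + h) - f t <= (D + e) * h.

Lemma expR_sub_ge (k t h : R) :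
  expR (k * t) * (k * h) <= expR (k * (t + h)) - expR (k * t).
Proof.
rewrite mulrDr expRD -subr_ge0.
rewrite (_ : _ - _ = expR (k * t) * (expR (k * h) - (1 + k * h))); last by ring.
by rewrite mulr_ge0 ?expR_ge0// subr_ge0 expR_ge1Dx.
Qed.

Lemma expR_lipschitz (k T s t : R) : 0 <= k -> s <= T -> t <= T ->
  `|expR (k * t) - expR (k * s)| <= k * expR (k * T) * `|t - s|.
Proof.
move=> k0; wlog st : s t / s <= t => [hw sT tT|sT tT].
  have [st|/ltW ts] := leP s t; first exact: hw.
  by rewrite distrC (distrC t) hw.
have ker : expR (k * s) <= expR (k * t) by rewrite ler_expR ler_wpM2l.
rewrite !ger0_norm ?subr_ge0//.
have := expR_sub_ge k t (s - t); rewrite (addrC t) subrK.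
have : expR (k * t) <= expR (k * T) by rewrite ler_expR ler_wpM2l.
rewrite -subr_ge0 => /(mulr_ge0 (mulr_ge0 k0 (_ : 0 <= t - s))).
by rewrite subr_ge0 => /(_ st); lra.
Qed.

(** The rate of growth is controlled by the past supremum of phi, so phi is
weighed by exp (- k t). With S the supremum of the weighted phi, the
hypothesis holds at time t with M = S exp (k t); integrating it gives phi t
<= phi 0 + d T + (c / k) S exp (k t), and k = 2 c + 1 makes c / k <= 1 / 2,
so that S is absorbed. *)
Lemma gronwall_sup (phi : R -> R) (T Lp d c : R) : 0 <= T ->
  (forall t, 0 <= t <= T -> 0 <= phi t) ->
  (forall s t, 0 <= s <= T -> 0 <= t <= T ->
     `|phi t - phi s| <= Lp * `|t - s|) ->
  0 <= d -> 0 <= c ->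
  {ae mu, forall t, 0 < t < T -> forall M,
    (forall s, 0 <= s <= t -> phi s <= M) ->
    upper_derivative_le phi t (d + c * M)} ->
  forall t, 0 <= t <= T ->
    phi t <= 2 * (phi 0 + d * T) * expR ((2 * c + 1) * t).
Proof.
move=> T0 phi0 phiL d0 c0 phiae.
set k := 2 * c + 1; have k0 : 0 < k by rewrite /k; lra.
pose psi t := phi t * expR (- (k * t)).
pose P : set R := [set psi t | t in `[0, T]].
have T00 : 0 <= (0 : R) <= T by rewrite lexx.
have supP : has_sup P.
  split; first by exists (psi 0), 0; rewrite //= in_itv /= lexx.
  exists (phi 0 + `|Lp| * T) => _ [t + <-]; rewrite /= in_itv/= => t0T.
  have [t0 tT] := andP t0T.
  have e1 : expR (- (k * t)) <= 1.
    by rewrite -[leRHS]expR0 ler_expR oppr_le0 mulr_ge0// ltW.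
  apply: le_trans (ler_wpM2l (phi0 _ t0T) e1) _; rewrite mulr1.
  have := phiL 0 t T00 t0T; rewrite subr0 (ger0_norm t0) => phit.
  have : Lp * t <= `|Lp| * T.
    exact: le_trans (ler_wpM2r t0 (ler_norm Lp)) (ler_wpM2l (normr_ge0 Lp) tT).
  by move: phit; rewrite ler_norml => /andP[_]; lra.
set S := sup P.
have phiS s : 0 <= s <= T -> phi s <= S * expR (k * s).
  move=> sT; rewrite -ler_pdivrMr ?expR_gt0// -expRN.
  by apply: sup_upper_bound => //; exists s => //=; rewrite in_itv.
have S0 : 0 <= S.
  have := phiS _ T00; rewrite mulr0 expR0 mulr1; apply: le_trans.
  exact: phi0.
have key t : 0 <= t <= T -> phi t <= phi 0 + d * T + S / 2 * expR (k * t).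
  move=> /andP[t0 tT].
  (* f subtracts from phi an antiderivative of the bound on its rate. *)
  pose f s := phi s - d * s - c * S / k * expR (k * s).
  have dT : d * t <= d * T by rewrite ler_wpM2l.
  have : f t <= f 0.
    pose Lf := Lp + d + c * S / k * (k * expR (k * T)).
    have cSk : 0 <= c * S / k by rewrite divr_ge0 ?mulr_ge0// ltW.
    apply: (@lipschitz_nonincreasing f 0 t Lf) => //.
      move=> u v /andP[u0 ut] /andP[v0 vt].
      have uT := le_trans ut tT; have vT := le_trans vt tT.
      have := phiL u v; rewrite u0 uT v0 vT => /(_ isT isT) H1.
      have := ler_wpM2l cSk (expR_lipschitz (ltW k0) uT vT) => H2.
      rewrite (_ : f v - f u = (phi v - phi u) - d * (v - u) -
          c * S / k * (expR (k * v) - expR (k * u))); last by rewrite /f; ring.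
      apply: le_trans (ler_normB _ _) _.
      have := ler_normB (phi v - phi u) (d * (v - u)).
      rewrite (normrM (c * S / k)) (normrM d).
      rewrite (ger0_norm cSk) (ger0_norm d0) /Lf.
      move: H1 H2.
      move: `|v - u| `|phi v - phi u| `|_ - expR _| => x y z.
      by lra.
    apply: negligibleS phiae => s /=; apply: contra_not.
    move=> phis /andP[s0 st] e e0.
    have sT : 0 < s < T by rewrite s0 (lt_le_trans st).
    have [|r r0 rh] := phis sT (S * expR (k * s)) _ e e0.
      move=> u /andP[u0 us]; apply: le_trans (phiS _ _) _.
        by rewrite u0 (le_trans us)// ltW//; case/andP: sT.
      by rewrite ler_wpM2l// ler_expR ler_wpM2l// ltW.
    exists r => // h hr; have := rh h hr.
    have := ler_wpM2l cSk (expR_sub_ge k s h).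
    have -> : c * S / k * (expR (k * s) * (k * h)) = c * S * expR (k * s) * h.
      by field; rewrite gt_eqF.
    by rewrite /f; lra.
  rewrite /f !mulr0 expR0 mulr1 subr0.
  have cSk : c * S / k <= S / 2.
    rewrite ler_pdivrMr// mulrAC ler_pdivlMr//.
    by rewrite /k; nra.
  have := ler_wpM2r (expR_ge0 (k * t)) cSk.
  have : 0 <= c * S / k by rewrite divr_ge0 ?mulr_ge0// ltW.
  lra.
have SA : S <= 2 * (phi 0 + d * T).
  suff : S <= phi 0 + d * T + S / 2 by lra.
  apply: ge_sup; first by case: supP.
  move=> _ [t + <-]; rewrite /= in_itv/= => t0T.
  rewrite /psi expRN ler_pdivrMr ?expR_gt0//.
  apply: le_trans (key t t0T) _.
  have kt1 : 1 <= expR (k * t).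
    by rewrite -[leLHS]expR0 ler_expR mulr_ge0// ?(ltW k0)//; case/andP: t0T.
  have : 0 <= phi 0 + d * T by rewrite addr_ge0 ?phi0// mulr_ge0.
  by move: kt1; move: (expR (k * t)) (phi 0 + d * T) => x y; nra.
move=> t t0T; apply: le_trans (phiS _ t0T) _.
by rewrite ler_wpM2r ?expR_ge0.
Qed.

End Growth.

(** * Scalar characterization of Bochner integrals *)

(** The integral of a nonnegative function is a supremum over simple functions
below it, hence monotone even without measurability.  This matters for s |->
|g s - G s| in the definition of the Bochner integral. *)
Lemma le_lower_integral d (T : measurableType d) (R : realType)
    (mu : {measure set T -> \bar R}) (D : set T) (f g : T -> \bar R) :
  (forall x, D x -> (0 <= f x)%E) -> (forall x, D x -> (f x <= g x)%E) ->
  (\int[mu]_(x in D) f x <= \int[mu]_(x in D) g x)%E.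
Proof.
move=> f0 fg.
rewrite !ge0_integralE//; last first.
  by move=> x Dx; exact: le_trans (f0 x Dx) (fg x Dx).
apply: ereal_sup_le => _ [h /= hf <-]; exists h => //= x.
apply: le_trans (hf x) _; rewrite /patch; case: ifPn => // /set_mem Dx.
exact: fg.
Qed.

Section Bochner.
Context {R : realType}.
Implicit Types (G : R -> L2 R) (X Y Z : L2 R) (t : R).
Local Notation mu := (@lebesgue_measure R).

Definition lipschitz_upto (t L : R) G := forall r s : R, 0 <= r <= t ->
  0 <= s <= t -> L2norm (G s - G r) <= L * `|s - r|.

(** The Bochner integral of a simple curve, tested against a fixed vector, is
the integral of a real step function. *)
Lemma Rintegral_step (t : R) n (p : 'I_n -> set R) (c : 'I_n -> R) :
  (forall i, measurable (p i)) ->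
  mu.-integrable `[0, t] (EFin \o (fun s => \sum_i \1_(p i) s * c i)) /\
  \int[mu]_(s in `[0, t]) (\sum_i \1_(p i) s * c i) =
  \sum_i fine (mu (p i `&` `[0, t])) * c i.
Proof.
have mI : measurable (`[0, t] : set (measurableTypeR R)).
  exact: measurable_itv.
elim: n p c => [|n IH] p c mp.
  split; last first.
    rewrite big_ord0 -[RHS](mul0r (fine (mu `[0, t]))) -Rintegral_cst//.
    by apply: eq_Rintegral => s _; rewrite big_ord0.
  apply: (eq_integrable _ (cst 0%E)) => //; last exact: integrable0.
  by move=> s _ /=; rewrite big_ord0.
have [int1 eq1] := IH (p \o lift ord0) (c \o lift ord0) (fun i => mp _).
have mp0 : measurable (p ord0 : set (measurableTypeR R)) by exact: mp.
have int2 : mu.-integrable `[0, t] (EFin \o (\1_(p ord0) : R -> R)).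
  apply/integrableP; split.
    by apply/measurable_EFinP; exact: measurable_indic.
  under eq_integral => s _ do rewrite /= ger0_norm//.
  rewrite integral_indic//.
  apply: (@le_lt_trans _ _ (mu `[0, t])).
    by apply: measureIr.
  by apply: compact_finite_measure; exact: segment_compact.
have int3 : mu.-integrable `[0, t] (EFin \o (fun s => \1_(p ord0) s * c ord0)).
  rewrite (_ : EFin \o _ = fun s => ((c ord0)%:E * (EFin \o \1_(p ord0)) s)%E).
    exact: integrableZl.
  by apply/funext => s /=; rewrite mulrC EFinM.
pose f0 s := \1_(p ord0) s * c ord0.
pose f1 s := \sum_i \1_(p (lift ord0 i)) s * c (lift ord0 i).
split.
  rewrite (_ : EFin \o _ = ((EFin \o f0) \+ (EFin \o f1))%E).
    exact: integrableD.
  by apply/funext => s /=; rewrite big_ord_recl EFinD.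
under eq_Rintegral do rewrite big_ord_recl.
rewrite RintegralD// big_ord_recl eq1; congr (_ + _).
by rewrite RintegralZr// /Rintegral integral_indic.
Qed.

Lemma lipschitz_integrable (h : R -> R) (t M : R) :
  (forall r s, 0 <= r <= t -> 0 <= s <= t -> `|h s - h r| <= M * `|s - r|) ->
  mu.-integrable `[0, t] (EFin \o h).
Proof.
move=> hL; apply: continuous_compact_integrable; first exact: segment_compact.
apply/subspace_continuousP => x; rewrite /= in_itv/= => x0t.
apply/cvgrPdist_le => /= e e0.
have M0 : 0 < `|M| + 1 by rewrite ltr_wpDl.
near=> s.
have s0t : 0 <= s <= t.
  near: s; near=> s; suff : `[0, t]%classic s by rewrite /= in_itv.
  by near: s; exact: withinT.
rewrite distrC; apply: le_trans (hL _ _ x0t s0t) _.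
have xs : `|x - s| < e / (`|M| + 1).
  near: s; apply: cvg_within; apply: nbhsx_ballx.
  by rewrite divr_gt0.
rewrite distrC; move: xs; rewrite ltr_pdivlMr// mulrC => /ltW; apply: le_trans.
by rewrite ler_wpM2r// (le_trans (ler_norm M))// lerDl.
Unshelve. all: by end_near. Qed.

Lemma lipschitz_inner_integrable t L G Z : lipschitz_upto t L G ->
  mu.-integrable `[0, t] (EFin \o (fun s => L2inner (G s) Z)).
Proof.
move=> GL; apply: (@lipschitz_integrable _ _ (L * L2norm Z)) => r s rt st.
rewrite -L2innerBl; apply: le_trans (L2_cauchy_schwarz _ _) _.
by rewrite mulrAC ler_wpM2r ?L2norm_ge0// GL.
Qed.

(** Testing against Z commutes with the limit defining the Bochner integral,
since |<g s - G s, Z>| <= |g s - G s| |Z| for the approximating simple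
curves g. The Lipschitz bound on G is there to make the right-hand side a
genuine integral. *)
Lemma bochner_inner t L G Y Z : lipschitz_upto t L G ->
  is_bochner_integral `[0, t] G Y ->
  L2inner Y Z = \int[mu]_(s in `[0, t]) L2inner (G s) Z.
Proof.
move=> GL [g [_ gG gY]].
have mI : measurable (`[0, t] : set (measurableTypeR R)).
  exact: measurable_itv.
have intG := lipschitz_inner_integrable Z GL.
apply/eqP; rewrite -subr_eq0 -normr_le0; apply/ler_addgt0Pr => e e0.
rewrite add0r.
have Z0 : 0 < L2norm Z + 1 by rewrite ltr_wpDl ?L2norm_ge0.
(* |Z| + 1 replaces |Z| in order to divide when Z is null. *)
pose e' := e / 2 / (L2norm Z + 1).
have e'0 : 0 < e' by rewrite !divr_gt0.
have [k [gYk gGk]] : exists k,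
    L2norm (simple_curve_integral `[0, t] (g k) - Y) <= e' /\
    (\int[mu]_(s in `[0%R, t])
       (L2norm (simple_curve_fun (g k) s - G s))%:E <= e'%:E)%E.
  near \oo => k; exists k; split.
    near: k; move/cvgr_dist_le : gY => /(_ _ e'0); apply: filterS => k.
    by rewrite sub0r normrN; apply: le_trans; exact: ler_norm.
  near: k; case/fine_cvgP : gG => gfin /cvgr_dist_le/(_ _ e'0).
  move: gfin; apply: filterS2 => k kfin /=; rewrite sub0r normrN => ke.
  by rewrite -(fineK kfin) lee_fin; apply: le_trans ke; exact: ler_norm.
have gkE s : L2inner (simple_curve_fun (g k) s) Z =
    \sum_i \1_(@piece _ (g k) i) s * L2inner (value i) Z.
  by rewrite L2inner_suml; apply: eq_bigr => i _; rewrite L2innerZl.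
have [intg intgE] := @Rintegral_step t _ (@piece _ (g k))
  (fun i => L2inner (value i) Z) (@measurable_piece _ (g k)).
pose f s := L2inner (simple_curve_fun (g k) s) Z.
have {}intg : mu.-integrable `[0, t] (EFin \o f).
  by apply: eq_integrable intg => // s _ /=; rewrite /f gkE.
have {}intgE : \int[mu]_(s in `[0, t]) f s =
    L2inner (simple_curve_integral `[0, t] (g k)) Z.
  under eq_Rintegral do rewrite /f gkE.
  rewrite intgE L2inner_suml; apply: eq_bigr => i _; by rewrite L2innerZl.
have -> : L2inner Y Z - \int[mu]_(s in `[0, t]) L2inner (G s) Z =
    L2inner (Y - simple_curve_integral `[0, t] (g k)) Z +
    \int[mu]_(s in `[0, t]) (f s - L2inner (G s) Z).
  by rewrite RintegralB// intgE L2innerBl; ring.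
have intB : mu.-integrable `[0, t] (EFin \o (fun s => f s - L2inner (G s) Z)).
  rewrite (_ : EFin \o _ =
    ((EFin \o f) \- (EFin \o (fun s => L2inner (G s) Z)))%E)//.
  exact: integrableB.
rewrite (splitr e); apply: le_trans (ler_normD _ _) _; apply: lerD.
  apply: le_trans (L2_cauchy_schwarz _ _) _; rewrite L2normC.
  have -> : e / 2 = e' * (L2norm Z + 1) by rewrite /e' divfK// gt_eqF.
  by rewrite ler_pM ?L2norm_ge0// lerDl.
have intA : mu.-integrable `[0, t]
    (EFin \o (fun s => `|f s - L2inner (G s) Z|)).
  by have := integrable_abse intB; apply: eq_integrable.
apply: le_trans (le_normr_Rintegral mI intB) _.
have -> : e / 2 = e' * (L2norm Z + 1) by rewrite /e' divfK// gt_eqF.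
rewrite -ler_pdivrMr// -RintegralZr// -lee_fin fineK; last first.
  apply: integrable_fin_num => //.
  rewrite (_ : (fun _ => _) = (fun s => ((L2norm Z + 1)^-1)%:E *
    (EFin \o (fun s => `|f s - L2inner (G s) Z|)%R) s)%E).
    exact: integrableZl.
  by apply/funext => s /=; rewrite mulrC EFinM.
apply: le_trans gGk; apply: le_lower_integral => s _.
  by rewrite lee_fin divr_ge0// ltW.
rewrite lee_fin ler_pdivrMr// /f -L2innerBl.
apply: le_trans (L2_cauchy_schwarz _ _) _.
by rewrite ler_wpM2l ?L2norm_ge0// lerDl.
Unshelve. all: by end_near. Qed.

Lemma Rintegral_bound (t b : R) (h : R -> R) : 0 <= t ->
  mu.-integrable `[0, t] (EFin \o h) ->
  (forall s, 0 <= s <= t -> `|h s| <= b) ->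
  `|\int[mu]_(s in `[0, t]) h s| <= b * t.
Proof.
move=> t0 hint hb.
have mI : measurable (`[0, t] : set (measurableTypeR R)).
  exact: measurable_itv.
have muI : fine (mu `[0, t]) = t.
  rewrite lebesgue_measure_itv/= lte_fin; case: ltP => [_|t0'].
    by rewrite oppr0 adde0.
  by apply/eqP; rewrite eq_le t0.
have cint : mu.-integrable `[0, t] (EFin \o cst b).
  apply: (@lipschitz_integrable _ _ 0) => r s _ _.
  by rewrite /= subrr normr0 mul0r.
apply: le_trans (le_normr_Rintegral mI hint) _.
rewrite -{2}muI -Rintegral_cst//; apply: le_Rintegral => //.
  by have := integrable_abse hint; apply: eq_integrable.
Qed.

Lemma bochner_diff_bound t L1 L2 G1 G2 Y1 Y2 Z b : 0 <= t ->
  lipschitz_upto t L1 G1 -> lipschitz_upto t L2 G2 ->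
  is_bochner_integral `[0, t] G1 Y1 -> is_bochner_integral `[0, t] G2 Y2 ->
  (forall s, 0 <= s <= t -> `|L2inner (G1 s - G2 s) Z| <= b) ->
  `|L2inner (Y1 - Y2) Z| <= b * t.
Proof.
move=> t0 lip1 lip2 Y1E Y2E bnd.
have mI : measurable (`[0, t] : set (measurableTypeR R)).
  exact: measurable_itv.
have int1 := lipschitz_inner_integrable Z lip1.
have int2 := lipschitz_inner_integrable Z lip2.
rewrite L2innerBl (bochner_inner Z lip1 Y1E) (bochner_inner Z lip2 Y2E).
rewrite -RintegralB//; apply: Rintegral_bound => // [|s /bnd].
  rewrite (_ : EFin \o _ = ((EFin \o (fun s => L2inner (G1 s) Z)) \-
    (EFin \o (fun s => L2inner (G2 s) Z)))%E)//.
  exact: integrableB.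
by rewrite L2innerBl.
Qed.

(** Test the integral against itself. *)
Lemma bochner_norm_le t L G Y b : 0 <= t -> 0 <= b -> lipschitz_upto t L G ->
  is_bochner_integral `[0, t] G Y ->
  (forall s, 0 <= s <= t -> L2norm (G s) <= b) -> L2norm Y <= b * t.
Proof.
move=> t0 b0 lip YE bnd.
have [->|Y0] := eqVneq (L2norm Y) 0; first by rewrite mulr_ge0.
have {}Y0 : 0 < L2norm Y by rewrite lt_def Y0 L2norm_ge0.
rewrite -(ler_pM2r Y0) -expr2 L2norm_sqr (bochner_inner Y lip YE) mulrAC.
apply: le_trans (ler_norm _) _; apply: Rintegral_bound => // [|s /bnd Gb].
  exact: lipschitz_inner_integrable lip.
apply: le_trans (L2_cauchy_schwarz _ _) _.
by rewrite ler_wpM2r ?L2norm_ge0.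
Qed.

End Bochner.

(** * Projection onto step functions *)

Section Steps.
Context {R : realType} {N : nat} (m : 'I_N -> R).
Implicit Types (X Y Z : L2 R) (x : 'I_N -> R) (i j : 'I_N).
Local Notation mO := (mOmega R).
Hypothesis m_simplex : simplex m.

Lemma mOmega_fin (A : set R) : measurable A -> (mO A < +oo)%E.
Proof.
move=> mA; rewrite /mOmega /mrestr.
apply: (@le_lt_trans _ _ (@lebesgue_measure R (Omega R))).
  by apply: measureIr; [exact: mA|exact: measurable_Omega].
by rewrite /Omega lebesgue_measure_itv/= lte01 oppr0 adde0 ltry.
Qed.

Lemma indic_L2 (A : set R) : measurable A ->
  {E : L2 R | (E : R -> R) = \1_A}.
Proof.
move=> mA; have AL : (\1_A : R -> R) \in Lfun mO 2%:E.
  rewrite inE; apply/andP; split; rewrite inE/=.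
    exact: measurable_indic.
  rewrite /finite_norm unlock /=; apply: poweR_lty.
  have mA' : measurable (A : set (measurableTypeR R)) by exact: mA.
  apply: (@le_lt_trans _ _ (\int[mO]_u (\1_A u)%:E)%E); last first.
    by rewrite integral_indic// setIT; exact: mOmega_fin.
  rewrite le_eqVlt; apply/orP; left; apply/eqP; apply: eq_integral => u _ /=.
  rewrite powR_mulrn// indicE.
  by case: (u \in A); rewrite ?normr1 ?normr0 ?expr1n ?expr0n.
by exists (Lfun_Sub (one_le_two R) AL).
Qed.

Lemma measurable_W i : measurable (W m i).
Proof. exact: measurable_itv. Qed.

Definition W_indic i : L2 R := sval (indic_L2 (measurable_W i)).

Lemma W_indicE i : (W_indic i : R -> R) = \1_(W m i).
Proof. exact: svalP (indic_L2 (measurable_W i)). Qed.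

Lemma w_homo (k l : nat) : (k <= l)%N -> w m k <= w m l.
Proof.
move=> kl; rewrite /w [leRHS]big_mkcond [leLHS]big_mkcond.
apply: ler_sum => i _.
case: ifPn => [ik|_]; first by rewrite (leq_trans ik kl).
by case: ifPn => // _; rewrite ltW//; case: m_simplex.
Qed.

Lemma W_le (u v : R) i j : W m i u -> W m j v -> u <= v -> (i <= j)%N.
Proof.
rewrite /W /= !in_itv/= => /andP[iu _] /andP[_ vj] uv.
rewrite leqNgt; apply/negP => ji.
by have := lt_le_trans vj (le_trans (w_homo ji) iu); rewrite ltNge uv.
Qed.

Lemma W_inj (u : R) i j : W m i u -> W m j u -> i = j.
Proof.
move=> iu ju; apply/val_inj/eqP; rewrite eqn_leq.
by rewrite (W_le iu ju)// (W_le ju iu).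
Qed.

(** i is the last index with w i <= u, that is one less than the first k with
u < w k. *)
Lemma W_cover (u : R) : Omega R u -> exists i, W m i u.
Proof.
rewrite /Omega /= in_itv/= => /andP[u0 u1].
have wN : u < w m N.
  rewrite (lt_le_trans u1)// /w.
  by under eq_bigl do rewrite ltn_ord; case: m_simplex => _ ->.
have ex : exists k, u < w m k by exists N.
case: (ex_minnP ex) => -[|k] uk kmin.
  by move: uk; rewrite /w big_pred0// ltNge ltW.
have kN : (k < N)%N := kmin _ wN.
exists (Ordinal kN); rewrite /W /= in_itv/= uk andbT leNgt.
by apply/negP => /kmin; rewrite ltnn.
Qed.

Lemma step_funE x i (u : R) : W m i u -> step_fun m x u = x i.
Proof.
move=> iu; rewrite /step_fun (bigD1 i)//= big1 ?addr0 => [|j ji].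
  by rewrite indicE mem_set ?mulr1.
rewrite indicE memNset ?mulr0// => ju.
by move: ji; rewrite (W_inj ju iu) eqxx.
Qed.

Lemma Km_sub_K X : Km m X -> K X.
Proof.
move=> [x xhomo Xx]; exists (step_fun m x) => // u v.
rewrite !inE => /W_cover[i iu] /W_cover[j jv] uv.
by rewrite (step_funE x iu) (step_funE x jv) xhomo// (W_le iu jv).
Qed.

Lemma Km_sub_Hm X : Km m X -> Hm m X.
Proof. by move=> [x _ Xx]; exists x. Qed.

Lemma HmB X Y : Hm m X -> Hm m Y -> Hm m (X - Y).
Proof.
move=> [x Xx] [y Yy]; exists (fun i => x i - y i).
have F := ae_filter_ringOfSetsType mO.
apply: (@filterS2 _ _ F _ _ _ _ Xx Yy) => u Xu Yu _.
have -> : (X - Y : L2 R) u = X u - Y u by [].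
rewrite Xu// Yu// /step_fun -sumrB.
by apply: eq_bigr => i _; rewrite mulrBl.
Qed.

Lemma HmP X : Hm m X <-> exists x, L2eq X (\sum_i x i *: W_indic i).
Proof.
have E x : (\sum_i x i *: W_indic i : L2 R) = step_fun m x :> (R -> R).
  apply/funext => u; rewrite /step_fun.
  elim/big_ind2 : _ => // [? ? ? ? <- <-//|i _].
  by rewrite L2_scale W_indicE.
by split => -[x Xx]; exists x; move: Xx; rewrite /L2eq E.
Qed.

Lemma W_indic_ortho i j : i != j -> L2inner (W_indic i) (W_indic j) = 0.
Proof.
move=> ij; rewrite -(mul0r (fine (mO setT))) -Rintegral_cst//.
apply: eq_Rintegral => u _; rewrite !W_indicE !indicE.
have [iu|iu] := pselect (W m i u); last by rewrite memNset// mul0r.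
have ju : ~ W m j u by move=> /(W_inj iu) ijE; rewrite ijE eqxx in ij.
by rewrite (memNset ju) mulr0.
Qed.

(** The indicators of the intervals are orthogonal, so the projection is the
usual sum of normalized coefficients. *)
Lemma orth_proj_ex Z :
  exists Y, Hm m Y /\ forall Z', Hm m Z' -> L2inner (Z - Y) Z' = 0.
Proof.
pose q i := L2inner (W_indic i) (W_indic i).
pose c i := L2inner Z (W_indic i) / q i.
exists (\sum_i c i *: W_indic i); split.
  by apply/HmP; exists c; exact: ae_eq_refl.
move=> Z' /HmP[x Z'x]; rewrite L2innerC (eq_L2inner _ Z'x) L2inner_suml.
apply: big1 => i _; rewrite L2innerZl L2innerBr L2innerC; apply/eqP.
rewrite mulf_eq0 subr_eq0; apply/orP; right; apply/eqP.
rewrite [RHS]L2innerC L2inner_suml (bigD1 i)//= big1 ?addr0 => [|j ji].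
(* If the indicator has norm 0, its coefficient is 0 by Cauchy-Schwarz, in
   agreement with division by 0. *)
  rewrite L2innerZl -/(q i) /c; have [q0|q0] := eqVneq (q i) 0.
    rewrite q0 mulr0; apply/eqP; rewrite -sqrf_eq0 eq_le sqr_ge0 andbT.
    by have := L2inner_sqr_le Z (W_indic i); rewrite -/(q i) q0 mulr0.
  by rewrite divfK.
by rewrite L2innerZl W_indic_ortho// mulr0.
Qed.

Lemma orth_projP Z : Hm m (orth_proj (Hm m) Z) /\
  forall Z', Hm m Z' -> L2inner (Z - orth_proj (Hm m) Z) Z' = 0.
Proof. exact: (xgetPex 0 (orth_proj_ex Z)). Qed.

Lemma orth_proj_contract Z1 Z2 :
  L2norm (orth_proj (Hm m) Z1 - orth_proj (Hm m) Z2) <= L2norm (Z1 - Z2).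
Proof.
have := orth_projP Z1; have := orth_projP Z2.
move: (orth_proj _ Z1) (orth_proj _ Z2) => P1 P2 [H2 o2] [H1 o1].
have [->|P0] := eqVneq (L2norm (P1 - P2)) 0; first exact: L2norm_ge0.
have {}P0 : 0 < L2norm (P1 - P2) by rewrite lt_def P0 L2norm_ge0.
rewrite -(ler_pM2r P0) -expr2 L2norm_sqr; apply: le_trans (L2inner_le _ _).
have /eqP := o1 _ (HmB H1 H2); have /eqP := o2 _ (HmB H1 H2).
rewrite !(L2innerBl _ _ (P1 - P2)) !subr_eq0 => /eqP -> /eqP ->.
exact: lexx.
Qed.

Lemma orth_proj_norm Z : L2norm (orth_proj (Hm m) Z) <= L2norm Z.
Proof.
have := orth_projP Z; move: (orth_proj _ Z) => P [HP oP].
have [->|P0] := eqVneq (L2norm P) 0; first exact: L2norm_ge0.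
have {}P0 : 0 < L2norm P by rewrite lt_def P0 L2norm_ge0.
rewrite -(ler_pM2r P0) -expr2 L2norm_sqr; apply: le_trans (L2inner_le _ _).
by have /eqP := oP _ HP; rewrite L2innerBl subr_eq0 => /eqP ->.
Qed.

End Steps.

(** * Normal cones, velocities and Galerkin forces *)

Section Curves.
Context {R : realType}.
Implicit Types (X : R -> L2 R) (D V W Y Z : L2 R) (C : set (L2 R)) (t : R).

Lemma has_derivativeP X t D : has_derivative X t D -> forall e : R, 0 < e ->
  exists2 d : R, 0 < d & forall h, h != 0 -> `|h| < d ->
    L2norm (h^-1 *: (X (t + h) - X t) - D) <= e.
Proof.
move=> XD e e0; move/cvgr_dist_le : XD => /(_ _ e0).
move=> /nbhs_ballP[d /= d0 dP]; exists d => // h h0 hd.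
have := dP h; rewrite /ball/= sub0r normrN => /(_ hd h0).
by rewrite sub0r normrN ger0_norm ?L2norm_ge0.
Qed.

(** At an interior time the curve can be moved forwards and backwards inside C,
so W is a normal vector with <W, D> <= 0 and <W, - D> <= 0. *)
Lemma subdiff_velocity C X t D W : (forall s, 0 <= s -> C (X s)) -> 0 < t ->
  has_derivative X t D -> subdiff C (X t) W -> L2inner W D = 0.
Proof.
move=> CX t0 XD sW; apply/eqP; rewrite -normr_le0; apply/ler_addgt0Pr => e e0.
rewrite add0r.
have W0 : 0 < L2norm W + 1 by rewrite ltr_wpDl ?L2norm_ge0.
have [d d0 dP] := has_derivativeP XD (divr_gt0 e0 W0).
have key h : h != 0 -> `|h| < d ->
    `|L2inner W D - h^-1 * L2inner W (X (t + h) - X t)| <= e.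
  move=> h0 hd; rewrite -L2innerZr -L2innerBr.
  apply: le_trans (L2_cauchy_schwarz _ _) _; rewrite L2normC.
  apply: le_trans (ler_wpM2l (L2norm_ge0 _) (dP h h0 hd)) _.
  rewrite mulrCA ger_pMr// ler_pdivrMr// mul1r lerDl//.
pose h := Num.min (d / 2) t.
have h0 : 0 < h by rewrite lt_min t0 divr_gt0.
have hd : h < d by rewrite gt_min ltr_pdivrMr// ltr_pMr// ltr1n.
have ht : h <= t by rewrite ge_min lexx orbT.
have := key h; rewrite gt_eqF// gtr0_norm// => /(_ isT hd).
have := key (- h); rewrite oppr_eq0 gt_eqF// normrN gtr0_norm// => /(_ isT hd).
have hi : 0 <= h^-1 by rewrite invr_ge0 ltW.
have := mulr_ge0_le0 hi (sW _ (CX (t + h) ltac:(lra))).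
have := mulr_ge0_le0 hi (sW _ (CX (t - h) ltac:(lra))).
rewrite invrN mulNr opprK.
move: (h^-1 * _) (h^-1 * _) => p q.
rewrite !ler_norml; lra.
Qed.

(** By orthogonality, |D|^2 = <V, D>. This bounds the velocity, and so the
normal vector V - D, by quantities that do not depend on C. *)
Lemma subdiff_velocity_le C X t D V : (forall s, 0 <= s -> C (X s)) -> 0 < t ->
  has_derivative X t D -> subdiff C (X t) (V - D) -> L2norm D <= L2norm V.
Proof.
move=> CX t0 XD sW.
have [->|D0] := eqVneq (L2norm D) 0; first exact: L2norm_ge0.
have {}D0 : 0 < L2norm D by rewrite lt_def D0 L2norm_ge0.
rewrite -(ler_pM2r D0) -expr2 L2norm_sqr; apply: le_trans (L2inner_le _ _).
have /eqP := subdiff_velocity CX t0 XD sW.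
rewrite L2innerBl subr_eq0 => /eqP ->.
exact: lexx.
Qed.

(** Expand |Dl + h Q|^2, where Q is the difference quotient of X1 - X2: the last
term is of order h^2. *)
Lemma has_derivativeB_upper (X1 X2 : R -> L2 R) t (D1 D2 : L2 R) :
  has_derivative X1 t D1 -> has_derivative X2 t D2 ->
  upper_derivative_le (fun s => L2norm (X1 s - X2 s) ^+ 2) t
    (2 * L2inner (D1 - D2) (X1 t - X2 t)).
Proof.
move=> XD1 XD2 e e0.
set Dl := X1 t - X2 t; set D := D1 - D2.
have Dl1 : 0 < L2norm Dl + 1 by rewrite ltr_wpDl ?L2norm_ge0.
(* The error e is shared: e' makes 2 (Q - D) cost at most e / 2 against Dl, and
   h < d3 makes h |Q|^2 at most e / 2. *)
pose e' := e / (8 * (L2norm Dl + 1)).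
have e'0 : 0 < e' by rewrite divr_gt0// mulr_gt0.
have [d1 d10 dP1] := has_derivativeP XD1 e'0.
have [d2 d20 dP2] := has_derivativeP XD2 e'0.
pose b := L2norm D + 2 * e'; pose d3 := e / (2 * (b ^+ 2 + 1)).
have b21 : 0 < b ^+ 2 + 1 by rewrite ltr_wpDl// sqr_ge0.
have d30 : 0 < d3 by rewrite divr_gt0// mulr_gt0.
exists (Num.min d1 (Num.min d2 d3)); first by rewrite !lt_min d10 d20.
move=> h /andP[h0]; rewrite !lt_min => /and3P[hd1 hd2 hd3].
pose Q := h^-1 *: (X1 (t + h) - X1 t) - h^-1 *: (X2 (t + h) - X2 t).
have QD : L2norm (Q - D) <= 2 * e'.
  have -> : Q - D = (h^-1 *: (X1 (t + h) - X1 t) - D1) -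
      (h^-1 *: (X2 (t + h) - X2 t) - D2).
    by apply/LfuneqP => u; rewrite /Q /D !L2E; ring.
  apply: le_trans (L2normB _ _) _; rewrite mulrDl mul1r; apply: lerD.
    by apply: dP1; rewrite ?gt_eqF// gtr0_norm.
  by apply: dP2; rewrite ?gt_eqF// gtr0_norm.
have Qb : L2norm Q <= b.
  rewrite -(subrK D Q) addrC; apply: le_trans (L2normD _ _) _.
  by rewrite lerD2l.
have -> : X1 (t + h) - X2 (t + h) = Dl + h *: Q.
  by apply/LfuneqP => u; rewrite /Q /Dl !L2E; field; rewrite gt_eqF.
rewrite -/Dl; clearbody Q D Dl.
rewrite !L2norm_sqr !(L2innerDl, L2innerDr, L2innerZl, L2innerZr).
rewrite (L2innerC Dl Q).
have : L2inner Q Dl <= L2inner D Dl + 2 * e' * L2norm Dl.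
  rewrite -lerBlDl -L2innerBl; apply: le_trans (L2inner_le _ _) _.
  by rewrite ler_wpM2r ?L2norm_ge0.
have : 2 * e' * L2norm Dl <= e / 4.
  rewrite (_ : e / 4 = 2 * e' * (L2norm Dl + 1)); last first.
    by rewrite /e'; field; rewrite gt_eqF.
  by rewrite ler_wpM2l ?lerDl// mulr_ge0// ltW.
have : h * L2inner Q Q <= e / 2.
  rewrite -L2norm_sqr; apply: (@le_trans _ _ (d3 * (b ^+ 2 + 1))).
    rewrite ler_pM ?sqr_ge0// ?(ltW h0) ?(ltW hd3)//.
    rewrite ler_wpDr// ler_sqr ?nnegrE ?L2norm_ge0//.
    exact: le_trans (L2norm_ge0 _) Qb.
  rewrite le_eqVlt; apply/orP; left; apply/eqP; rewrite /d3.
  by field; rewrite gt_eqF.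
move: (L2inner Dl Dl) (L2inner Q Q) (L2inner Q Dl) (L2inner D Dl) => p q r s.
move: (2 * e' * L2norm Dl) => u H1 H2 H3.
have := ler_wpM2l (ltW h0) H1; have := ler_wpM2l (ltW h0) H2.
have := ler_wpM2l (ltW h0) H3; lra.
Qed.

(** What the stability estimate needs from a discretization (C, G) of (K, F):
G behaves like F followed by a contraction which is invisible to differences
of elements of C, such as the orthogonal projection onto a subspace containing
C. *)
Definition galerkin (F : L2 R -> L2 R) C (G : L2 R -> L2 R) : Prop :=
  [/\ C `<=` K,
      forall Z A B : L2 R, K Z -> C A -> C B -> L2inner (G Z - F Z) (A - B) = 0,
      forall X1 X2 : L2 R, K X1 -> K X2 ->
        L2norm (G X1 - G X2) <= L2norm (F X1 - F X2) &
      forall Z, K Z -> L2norm (G Z) <= L2norm (F Z)].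

Lemma galerkin_refl (F : L2 R -> L2 R) : galerkin F K F.
Proof. by split => // *; rewrite subrr L2inner0l. Qed.

Lemma galerkin_Km (F : L2 R -> L2 R) N (m : 'I_N -> R) : simplex m ->
  galerkin F (Km m) (Fm m F).
Proof.
move=> ms; split => [Z|Z A B KZ CA CB|Z1 Z2 _ _|Z _].
- exact: Km_sub_K.
- have [_ o] := orth_projP ms (F Z).
  rewrite -opprB L2innerNl o ?oppr0//.
  by apply: HmB; exact: Km_sub_Hm.
- exact: orth_proj_contract.
- exact: orth_proj_norm.
Qed.

Lemma L2norm_sqr_lipschitz (X1 X2 : R -> L2 R) T L1 L2 : 0 <= T ->
  lipschitz_upto T L1 X1 -> lipschitz_upto T L2 X2 ->
  exists L, forall s t, 0 <= s <= T -> 0 <= t <= T ->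
    `|L2norm (X1 t - X2 t) ^+ 2 - L2norm (X1 s - X2 s) ^+ 2| <= L * `|t - s|.
Proof.
move=> T0 lip1 lip2.
have T00 : 0 <= (0 : R) <= T by rewrite lexx.
pose n t := L2norm (X1 t - X2 t).
have nL s t : 0 <= s <= T -> 0 <= t <= T ->
    `|n t - n s| <= (`|L1| + `|L2|) * `|t - s|.
  move=> sT tT; apply: le_trans (L2norm_lip _ _) _.
  have -> : X1 t - X2 t - (X1 s - X2 s) = (X1 t - X1 s) - (X2 t - X2 s).
    by apply/LfuneqP => u; rewrite !L2E; ring.
  apply: le_trans (L2normB _ _) _; rewrite mulrDl; apply: lerD.
    by apply: le_trans (lip1 _ _ sT tT) _; rewrite ler_wpM2r// ler_norm.
  by apply: le_trans (lip2 _ _ sT tT) _; rewrite ler_wpM2r// ler_norm.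
pose B := n 0 + (`|L1| + `|L2|) * T.
have nB t : 0 <= t <= T -> n t <= B.
  move=> tT; have := nL 0 t T00 tT; rewrite ler_norml => /andP[_].
  have /andP[t0 tT'] := tT; rewrite subr0 (ger0_norm t0) /B => H.
  have : (`|L1| + `|L2|) * t <= (`|L1| + `|L2|) * T.
    by rewrite ler_wpM2l ?addr_ge0.
  lra.
exists ((`|L1| + `|L2|) * (2 * B)) => s t sT tT.
rewrite -/(n t) -/(n s) subr_sqr normrM mulrAC ler_pM// ?nL//.
rewrite ger0_norm ?addr_ge0 ?L2norm_ge0//.
by have := nB s sT; have := nB t tT; lra.
Qed.

Lemma Lip_locP C X T : Lip_loc C X -> 0 <= T -> exists L, lipschitz_upto T L X.
Proof. by move=> [_ XL] /XL[L XLL]; exists L. Qed.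

Lemma force_lipschitz_on F C G L X T Lx : galerkin F C G ->
  0 <= L ->
  (forall X1 X2 : L2 R, K X1 -> K X2 ->
     L2norm (F X1 - F X2) <= L * L2norm (X1 - X2)) ->
  (forall s, 0 <= s -> C (X s)) -> lipschitz_upto T Lx X ->
  lipschitz_upto T (L * Lx) (G \o X).
Proof.
move=> [CK _ GF _] L0 FL CX XL r s rT sT.
have [/andP[r0 _] /andP[s0 _]] := (rT, sT).
apply: le_trans (GF _ _ (CK _ (CX _ s0)) (CK _ (CX _ r0))) _.
apply: le_trans (FL _ _ (CK _ (CX _ s0)) (CK _ (CX _ r0))) _.
by rewrite -mulrA ler_wpM2l// XL.
Qed.

Lemma lipschitz_upto_sub T t L X : t <= T ->
  lipschitz_upto T L X -> lipschitz_upto t L X.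
Proof.
move=> tT XL r s /andP[r0 rt] /andP[s0 st].
by apply: XL; rewrite ?r0 ?s0 (le_trans _ tT).
Qed.

Section Gap.
Variables (F : L2 R -> L2 R) (L : R).
Hypothesis L0 : 0 <= L.
Hypothesis FL : forall X1 X2 : L2 R, K X1 -> K X2 ->
  L2norm (F X1 - F X2) <= L * L2norm (X1 - X2).
Variables (X2 : R -> L2 R) (V2 : L2 R) (T M2 B : R).
Hypothesis X2K : forall s, 0 <= s -> K (X2 s).
Hypothesis X2L : lipschitz_upto T M2 X2.
Hypothesis X2B : forall s, 0 <= s <= T -> L2norm (F (X2 s)) <= B.

(** X2 t need not lie in C, so Z replaces it wherever an element of C is called
for. The pairing of D1 - D2 with X1 t - X2 t splits into six terms: the
difference of the initial velocities; the forces tested on X1 t - Z, where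
G can be replaced by F; the forces on Z - X2 t, of order k; the normal
vector of C on Z - X1 t, nonpositive, and on X2 t - Z, of order k; the
normal vector of K on X1 t - X2 t, nonpositive because C is included in K. *)
Lemma velocity_gap (C : set (L2 R)) G (X1 : R -> L2 R) (V1 D1 D2 Y1 Y2 Z : L2 R)
    (L1 t k mu : R) :
  galerkin F C G -> (forall s, 0 <= s -> C (X1 s)) -> lipschitz_upto T L1 X1 ->
  0 < t -> t <= T -> has_derivative X1 t D1 ->
  is_bochner_integral `[0, t] (G \o X1) Y1 ->
  is_bochner_integral `[0, t] (F \o X2) Y2 ->
  subdiff C (X1 t) (V1 + Y1 - D1) -> subdiff K (X2 t) (V2 + Y2 - D2) ->
  C Z -> L2norm (Z - X2 t) <= k ->
  (forall s, 0 <= s <= t -> L2norm (X1 s - X2 s) <= mu) ->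
  L2inner (D1 - D2) (X1 t - X2 t) <=
    L2norm (V1 - V2) * mu + L * T * mu * (mu + k) +
    k * (2 * L2norm V1 + 3 * ((B + L * mu) * T) + B * T).
Proof.
move=> gal X1C X1L t0 tT XD1 Y1E Y2E sub1 sub2 CZ Zk Xmu.
have [CK orth _ Gle] := gal.
have X1K s : 0 <= s -> K (X1 s) by move=> /X1C /CK.
have t0' := ltW t0.
have k0 : 0 <= k := le_trans (L2norm_ge0 _) Zk.
have tt : 0 <= t <= t by rewrite t0' lexx.
have mu0 : 0 <= mu := le_trans (L2norm_ge0 _) (Xmu t tt).
have ts s : 0 <= s <= t -> 0 <= s /\ 0 <= s <= T.
  by move=> /andP[s0 st]; rewrite s0 (le_trans st tT).
have B0 : 0 <= B.
  apply: le_trans (L2norm_ge0 _) (X2B (_ : 0 <= 0 <= T)).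
  by rewrite lexx (le_trans t0').
have Lmu : 0 <= L * mu by rewrite mulr_ge0.
have lipG1 : lipschitz_upto t (L * L1) (G \o X1).
  apply: lipschitz_upto_sub tT _; exact: (force_lipschitz_on gal).
have lipF2 : lipschitz_upto t (L * M2) (F \o X2).
  apply: lipschitz_upto_sub tT _.
  exact: (force_lipschitz_on (galerkin_refl F)).
have F12 s : 0 <= s <= t -> L2norm (F (X1 s) - F (X2 s)) <= L * mu.
  move=> st; have [s0 _] := ts s st.
  apply: le_trans (FL (X1K _ s0) (X2K s0)) _.
  by rewrite ler_wpM2l// Xmu.
have Y2b : L2norm Y2 <= B * T.
  apply: (@le_trans _ _ (B * t)); last by rewrite ler_wpM2l.
  by apply: bochner_norm_le lipF2 Y2E _ => // s /ts[_]; exact: X2B.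
have Y1b : L2norm Y1 <= (B + L * mu) * T.
  apply: (@le_trans _ _ ((B + L * mu) * t)); last first.
    by rewrite ler_wpM2l// addr_ge0.
  apply: bochner_norm_le lipG1 Y1E _ => //; first by rewrite addr_ge0.
  move=> s st; have [s0 sT] := ts s st; apply: le_trans (Gle _ (X1K _ s0)) _.
  rewrite -(subrK (F (X2 s)) (F (X1 s))) addrC.
  apply: le_trans (L2normD _ _) _; apply: lerD; first exact: X2B.
  exact: F12.
have D1b : L2norm D1 <= L2norm V1 + L2norm Y1.
  apply: le_trans (L2normD _ _); exact: subdiff_velocity_le sub1.
have W1b : L2norm (V1 + Y1 - D1) <= 2 * (L2norm V1 + L2norm Y1).
  apply: le_trans (L2normB _ _) _; have := L2normD V1 Y1; lra.
have VD : L2inner (V1 - V2) (X1 t - X2 t) <= L2norm (V1 - V2) * mu.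
  by apply: le_trans (L2inner_le _ _) _; rewrite ler_wpM2l ?L2norm_ge0 ?Xmu.
have X1Z : L2norm (X1 t - Z) <= mu + k.
  apply: le_trans (L2norm_triangle _ (X2 t) _) _.
  by rewrite (L2normC (X2 t)) lerD// Xmu.
have Y12 : L2inner (Y1 - Y2) (X1 t - Z) <= L * T * mu * (mu + k).
  apply: (@le_trans _ _ (L * mu * (mu + k) * t)); last first.
    by have := ler_wpM2l (mulr_ge0 Lmu (addr_ge0 mu0 k0)) tT; lra.
  apply: le_trans (ler_norm _) _.
  apply: bochner_diff_bound lipG1 lipF2 Y1E Y2E _ => // s st.
  have [s0 _] := ts s st.
  have -> : L2inner ((G \o X1) s - (F \o X2) s) (X1 t - Z) =
      L2inner (F (X1 s) - F (X2 s)) (X1 t - Z).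
    have := orth (X1 s) _ _ (X1K s s0) (X1C t t0') CZ.
    rewrite !(L2innerBl _ _ (X1 t - Z)) /= => /eqP; rewrite subr_eq0 => /eqP ->.
    by [].
  apply: le_trans (L2_cauchy_schwarz _ _) _.
  by rewrite ler_pM ?L2norm_ge0// F12.
have YZ : L2inner (Y1 - Y2) (Z - X2 t) <= (L2norm Y1 + L2norm Y2) * k.
  apply: le_trans (L2inner_le _ _) _.
  by rewrite ler_pM ?L2norm_ge0// L2normB.
have W1Z : L2inner (V1 + Y1 - D1) (Z - X1 t) <= 0 by exact: sub1.
have W1X : L2inner (V1 + Y1 - D1) (X2 t - Z) <= 2 * (L2norm V1 + L2norm Y1) * k.
  apply: le_trans (L2inner_le _ _) _; rewrite (L2normC (X2 t)).
  by rewrite ler_pM ?L2norm_ge0.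
have W2X : L2inner (V2 + Y2 - D2) (X1 t - X2 t) <= 0 by apply: sub2; exact: X1K.
have -> : L2inner (D1 - D2) (X1 t - X2 t) =
    L2inner (V1 - V2) (X1 t - X2 t) + L2inner (Y1 - Y2) (X1 t - Z) +
    L2inner (Y1 - Y2) (Z - X2 t) + L2inner (V1 + Y1 - D1) (Z - X1 t) +
    L2inner (V1 + Y1 - D1) (X2 t - Z) + L2inner (V2 + Y2 - D2) (X1 t - X2 t).
  rewrite !(L2innerBl, L2innerDl, L2innerBr); ring.
have Y1k := ler_wpM2r k0 Y1b; have Y2k := ler_wpM2r k0 Y2b.
move: VD Y12 YZ W1Z W1X W2X Y1k Y2k.
move: (L2inner _ _) (L2inner _ _) (L2inner _ _) (L2inner _ _) (L2inner _ _)
  (L2inner _ _) (L2norm _) (L2norm _) (L2norm _) (L2norm _).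
move=> p q r s u v x y z w; lra.
Qed.

End Gap.

End Curves.

(** * Stability of Lagrangian solutions *)

Section Stability.
Context {R : realType}.
Implicit Types (X : R -> L2 R) (V W Y Z : L2 R) (C : set (L2 R)) (t : R).

(** Young's inequality turns the bound of [velocity_gap] into squares. As k <=
1, k^2 is absorbed into k; here n = |V1 - V2|, l = L T,
v = |V2| and b = B T. *)
Lemma gap_le (n mu k l v b : R) : 0 <= l -> 0 <= k <= 1 ->
  2 * (n * mu + l * mu * (mu + k) + k * (2 * (v + n) + 3 * (b + l * mu) + b)) <=
  3 * n ^+ 2 + k * (4 * l + 4 * v + 2 + 8 * b) + (1 + 6 * l) * mu ^+ 2.
Proof.
move=> l0 /andP[k0 k1].
have kk : k ^+ 2 <= k by have := ler_wpM2l k0 k1; rewrite mulr1 expr2.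
have := sqr_ge0 (n - mu); have := sqr_ge0 (k - n).
have := mulr_ge0 l0 (sqr_ge0 (k - mu)).
have := ler_wpM2l l0 kk.
rewrite !sqrrB; lra.
Qed.

Lemma L2norm_congr (X Y X' Y' : L2 R) : L2eq X X' -> L2eq Y Y' ->
  L2norm (X - Y) <= L2norm (X' - Y').
Proof.
move=> XX' YY'; have := L2norm_triangle X X' Y; have := L2norm_triangle X' Y' Y.
rewrite (L2norm_L2eq0 XX') (L2normC Y') (L2norm_L2eq0 YY'); lra.
Qed.

(** The constant depends on F, T and the solution X2 only, in particular not on
C, G or X1; the distance k from X2 to C enters to the first power. *)
Lemma stability (F : L2 R -> L2 R) X2 (Xbar2 Vbar2 : L2 R) (T : R) :
  force_lipschitz F -> 0 <= T -> lagrangian_solution F Xbar2 Vbar2 X2 ->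
  exists2 A : R, 0 <= A & forall C G (Xbar1 Vbar1 : L2 R) X1 (k : R),
    galerkin F C G -> solution C G Xbar1 Vbar1 X1 -> 0 <= k <= 1 ->
    (forall t, 0 <= t <= T -> exists2 Z, C Z & L2norm (Z - X2 t) <= k) ->
    forall t, 0 <= t <= T -> L2norm (X1 t - X2 t) ^+ 2 <=
      A * (L2norm (Xbar1 - Xbar2) ^+ 2 + L2norm (Vbar1 - Vbar2) ^+ 2 + k).
Proof.
move=> [L L0 FL] T0 [XL2 X20 sol2].
have [M2 X2L] := Lip_locP XL2 T0.
have X2K s : 0 <= s -> K (X2 s) by case: XL2 => + _; exact.
have T00 : 0 <= (0 : R) <= T by rewrite lexx.
pose B := L2norm (F (X2 0)) + L * `|M2| * T.
have X2B s : 0 <= s <= T -> L2norm (F (X2 s)) <= B.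
  move=> sT; have /andP[s0 sT'] := sT.
  rewrite -(subrK (F (X2 0)) (F (X2 s))) addrC.
  apply: le_trans (L2normD _ _) _; rewrite lerD2l.
  apply: le_trans (FL _ _ (X2K _ s0) (X2K _ (lexx 0))) _.
  rewrite -mulrA ler_wpM2l//; apply: le_trans (X2L _ _ T00 sT) _.
  rewrite subr0 (ger0_norm s0); apply: (@le_trans _ _ (`|M2| * s)).
    by rewrite ler_wpM2r// ler_norm.
  by rewrite ler_wpM2l.
have B0 : 0 <= B := le_trans (L2norm_ge0 _) (X2B _ T00).
pose l := L * T; have l0 : 0 <= l by rewrite mulr_ge0.
pose c2 := 4 * l + 4 * L2norm Vbar2 + 2 + 8 * (B * T).
have c20 : 0 <= c2.
  by rewrite !addr_ge0 ?mulr_ge0// L2norm_ge0.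
pose c := 1 + 6 * l; have c0 : 0 <= c by rewrite addr_ge0// mulr_ge0.
pose E := expR ((2 * c + 1) * T).
exists (2 * (1 + 3 * T + c2 * T) * E).
  by rewrite mulr_ge0 ?expR_ge0// mulr_ge0// !addr_ge0// mulr_ge0.
move=> C G Xbar1 Vbar1 X1 k gal [XL1 X10 sol1] k01 near t tT.
have [M1 X1L] := Lip_locP XL1 T0.
have X1C s : 0 <= s -> C (X1 s) by case: XL1 => + _; exact.
have /andP[k0 k1] := k01.
set nu := L2norm (Vbar1 - Vbar2).
have nu0 : 0 <= nu by exact: L2norm_ge0.
pose d := 3 * nu ^+ 2 + k * c2.
have d0 : 0 <= d by rewrite addr_ge0 ?mulr_ge0// sqr_ge0.
have [Lphi phiL] := L2norm_sqr_lipschitz T0 X1L X2L.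
have ae12 := negligibleU sol1 sol2.
have phi0 s : 0 <= s <= T -> 0 <= L2norm (X1 s - X2 s) ^+ 2.
  by move=> _; exact: sqr_ge0.
have phiae : {ae @lebesgue_measure R, forall s, 0 < s < T -> forall M : R,
    (forall r, 0 <= r <= s -> L2norm (X1 r - X2 r) ^+ 2 <= M) ->
    upper_derivative_le (fun r => L2norm (X1 r - X2 r) ^+ 2) s (d + c * M)}.
  apply: negligibleS ae12 => s /=; apply: contra_notP.
  move=> /not_orP[/contrapT + /contrapT + /andP[s0 /ltW sT] M phiM].
  move=> /(_ s0)[D1 [Y1 [XD1 Y1E sub1]]] /(_ s0)[D2 [Y2 [XD2 Y2E sub2]]].
  have s0T : 0 <= s <= T by rewrite (ltW s0).
  have [Z CZ Zk] := near s s0T.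
  have M0 : 0 <= M.
    by apply: le_trans (phiM s _); rewrite ?sqr_ge0// lexx (ltW s0).
  have Xmu r : 0 <= r <= s -> L2norm (X1 r - X2 r) <= Num.sqrt M.
    by move=> rs; apply: L2norm_le; rewrite ?sqrtr_ge0// sqr_sqrtr// phiM.
  have gap := velocity_gap L0 FL X2K X2L X2B gal X1C X1L s0 sT XD1 Y1E Y2E
    sub1 sub2 CZ Zk Xmu.
  have upper := has_derivativeB_upper XD1 XD2.
  suff le2 : 2 * L2inner (D1 - D2) (X1 s - X2 s) <= d + c * M.
    move=> e e0; have [r r0 rP] := upper e e0; exists r => // h hr.
    have /andP[h0 _] := hr.
    by apply: le_trans (rP h hr) _; rewrite ler_wpM2r ?lerD2r// ltW.
  have V1b : L2norm Vbar1 <= L2norm Vbar2 + nu.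
    by rewrite -{1}(subrK Vbar2 Vbar1) addrC; exact: L2normD.
  rewrite -{1}(sqr_sqrtr M0).
  apply: le_trans (gap_le nu (Num.sqrt M) (L2norm Vbar2) (B * T) l0 k01).
  rewrite ler_pM2l//; apply: le_trans gap _.
  rewrite -/nu -/l lerD2l ler_wpM2l// -lerBlDr.
  have -> : (B + L * Num.sqrt M) * T = B * T + l * Num.sqrt M.
    by rewrite /l; ring.
  lra.
apply: le_trans (gronwall_sup T0 phi0 phiL d0 c0 phiae tT) _.
have X0 : L2norm (X1 0 - X2 0) ^+ 2 <= L2norm (Xbar1 - Xbar2) ^+ 2.
  rewrite ler_sqr ?nnegrE ?L2norm_ge0//; exact: L2norm_congr.
have Et : expR ((2 * c + 1) * t) <= E.
  by rewrite ler_expR ler_wpM2l ?addr_ge0 ?mulr_ge0//; case/andP: tT.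
apply: (@le_trans _ _ (2 * (L2norm (Xbar1 - Xbar2) ^+ 2 + d * T) * E)).
  apply: ler_pM => //; first by rewrite mulr_ge0// addr_ge0 ?sqr_ge0// mulr_ge0.
  by rewrite ler_pM2l// lerD2r.
rewrite [leRHS]mulrAC ler_wpM2r ?expR_ge0//.
rewrite -!mulrA ler_pM2l// /d.
have := sqr_ge0 (L2norm (Xbar1 - Xbar2)); have := sqr_ge0 nu.
have : 0 <= c2 * T by rewrite mulr_ge0.
move: (L2norm (Xbar1 - Xbar2) ^+ 2) (nu ^+ 2) => x n c2T n0 x0.
have := mulr_ge0 T0 n0; have := mulr_ge0 T0 x0; have := mulr_ge0 T0 k0.
have := mulr_ge0 c2T n0; have := mulr_ge0 c2T x0.
lra.
Qed.

End Stability.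

(** * Uniform approximation, uniqueness and convergence *)

Section Approximation.
Context {R : realType}.

(** Density is used only at the times J h: on a time step of length h the
Lipschitz curve X moves by at most k / 2. *)
Lemma uniform_approximation (C : nat -> set (L2 R)) (X : R -> L2 R) (T k : R) :
  (forall Y : L2 R, K Y ->
     exists2 Yn : nat -> L2 R, forall n, C n (Yn n) & L2cvg Yn Y) ->
  Lip_loc K X -> 0 <= T -> 0 < k ->
  \forall n \near \oo, forall t, 0 <= t <= T ->
    exists2 Z, C n Z & L2norm (Z - X t) <= k.
Proof.
move=> dense XL T0 k0; have [M XM] := Lip_locP XL T0.
pose h := k / 2 / (`|M| + 1).
have M0 : 0 < `|M| + 1 by rewrite ltr_wpDl.
have h0 : 0 < h by rewrite !divr_gt0.
suff key : forall J : nat, \forall n \near \oo,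
  forall t, 0 <= t <= T -> t <= J%:R * h ->
    exists2 Z, C n Z & L2norm (Z - X t) <= k.
  have [J TJ] : exists J, T <= J%:R * h.
    exists (Num.bound (T / h)); rewrite -ler_pdivrMr// ltW// archi_boundP//.
    by rewrite divr_ge0// ltW.
  apply: filterS (key J) => n Jn t tT; apply: Jn => //.
  by apply: le_trans TJ; case/andP: tT.
have step J : \forall n \near \oo,
    exists2 Z, C n Z & L2norm (Z - X (J%:R * h)) <= k / 2.
  have [|Yn CYn cYn] := dense (X (J%:R * h)).
    by case: XL => XK _; apply: XK; rewrite mulr_ge0// ltW.
  move/cvgr_dist_le : cYn => /(_ (k / 2)) []; first by rewrite divr_gt0.
  move=> n0 _ n0P; exists n0 => // n /n0P /=.
  by rewrite sub0r normrN ger0_norm ?L2norm_ge0// => ?; exists (Yn n).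
have near_step J t n : 0 <= t <= T -> J%:R * h <= t -> t <= J.+1%:R * h ->
    (exists2 Z, C n Z & L2norm (Z - X (J%:R * h)) <= k / 2) ->
    exists2 Z, C n Z & L2norm (Z - X t) <= k.
  move=> tT Jt tJ [Z CZ Zk]; exists Z => //.
  apply: le_trans (L2norm_triangle _ (X (J%:R * h)) _) _.
  rewrite (splitr k); apply: lerD => //; rewrite L2normC.
  have JT : 0 <= J%:R * h <= T.
    by case/andP: tT => _ tT; rewrite mulr_ge0 ?(ltW h0)//= (le_trans Jt).
  apply: le_trans (XM _ _ JT tT) _; rewrite ger0_norm ?subr_ge0//.
  have -> : k / 2 = (`|M| + 1) * h by rewrite /h; field; rewrite gt_eqF.
  apply: (@le_trans _ _ ((`|M| + 1) * (t - J%:R * h))).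
    by rewrite ler_wpM2r ?subr_ge0// (le_trans (ler_norm M))// lerDl.
  rewrite ler_pM2l// lerBlDl; apply: le_trans tJ _.
  by rewrite -natr1 mulrDl mul1r.
elim=> [|J IH].
  apply: filterS (step 0%N) => n H t tT; rewrite mul0r => t0.
  apply: (near_step 0%N t n tT) H; first by rewrite mul0r; case/andP: tT.
  by rewrite mul1r (le_trans t0)// ltW.
apply: filterS2 IH (step J) => n IH H t tT tJ.
have [tJ'|/ltW Jt] := leP t (J%:R * h); first exact: IH.
exact: near_step H.
Qed.

Lemma L2eq_of_norm0 (X Y : L2 R) : L2norm (X - Y) = 0 -> L2eq X Y.
Proof.
move=> /L2norm_eq0 XY.
apply: (@filterS _ _ (ae_filter_ringOfSetsType (mOmega R)) _ _ _ XY).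
move=> u /(_ I); have -> : (X - Y : L2 R) u = X u - Y u by [].
by move=> /eqP; rewrite subr_eq0 => /eqP.
Qed.

Lemma L2cvg_sqr_le (Xn : nat -> L2 R) (X : L2 R) (e : R) :
  L2cvg Xn X -> 0 < e ->
  \forall n \near \oo, L2norm (Xn n - X) ^+ 2 <= e.
Proof.
move=> XnX e0; have m0 : 0 < Num.sqrt e by rewrite sqrtr_gt0.
move/cvgr_dist_le : XnX => /(_ _ m0); apply: filterS => n.
rewrite sub0r normrN ger0_norm ?L2norm_ge0// => ne.
by rewrite -(sqr_sqrtr (ltW e0)) ler_sqr ?nnegrE ?L2norm_ge0// ltW.
Qed.

End Approximation.

Theorem theorem5p1 (R : realType) (F : L2 R -> L2 R)
    (F_lip : force_lipschitz F) (F_bound : pointwise_linearly_bounded F)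
    (N : nat -> nat) (m : forall n, 'I_(N n) -> R)
    (m_simplex : forall n, simplex (m n))
    (m_dense : forall Y : L2 R, K Y ->
      exists2 Yn : nat -> L2 R, forall n, Km (m n) (Yn n) & L2cvg Yn Y)
    (Xbarn Vbarn : nat -> L2 R) (Xbar Vbar : L2 R)
    (Xbarn_Km : forall n, Km (m n) (Xbarn n))
    (Vbarn_Hm : forall n, Hm (m n) (Vbarn n))
    (Xbar_K : K Xbar)
    (Xbarn_cvg : L2cvg Xbarn Xbar) (Vbarn_cvg : L2cvg Vbarn Vbar)
    (Xn : nat -> R -> L2 R)
    (Xn_sol : forall n,
      discrete_lagrangian_solution (m n) F (Xbarn n) (Vbarn n) (Xn n))
    (X : R -> L2 R) (X_sol : lagrangian_solution F Xbar Vbar X) :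
  (forall Y : R -> L2 R, lagrangian_solution F Xbar Vbar Y ->
     forall t, 0 <= t -> L2eq (Y t) (X t)) /\
  (forall T eps : R, 0 <= T -> 0 < eps -> \forall n \near \oo,
     forall t, 0 <= t <= T -> L2norm (Xn n t - X t) < eps).
Proof.
split=> [Y Y_sol t t0|T eps T0 eps0].
  have [A _ stab] := stability F_lip t0 X_sol.
  apply: L2eq_of_norm0; apply/eqP; rewrite -sqrf_eq0 eq_le sqr_ge0 andbT.
  have := stab K F Xbar Vbar Y 0 (galerkin_refl F) Y_sol.
  rewrite !subrr L2norm0 expr0n/= !addr0 mulr0; apply.
  - by rewrite lexx ler01.
  - move=> s /andP[s0 _]; exists (X s); last by rewrite subrr L2norm0.
    by case: X_sol => -[XK _] _ _; exact: XK.
  - by rewrite t0 lexx.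
have [A A0 stab] := stability F_lip T0 X_sol.
(* Three errors, each at most e, are multiplied by A; e <= 1 because the
     distance to the cone must not exceed 1. *)
pose e := Num.min 1 (eps ^+ 2 / (4 * (A + 1))).
have A1 : 0 < 4 * (A + 1) by rewrite mulr_gt0// ltr_wpDl.
have e0 : 0 < e by rewrite lt_min ltr01/= divr_gt0// exprn_gt0.
have XL : Lip_loc K X by case: X_sol.
have XbarE := L2cvg_sqr_le Xbarn_cvg e0.
have VbarE := L2cvg_sqr_le Vbarn_cvg e0.
apply: filterS3 XbarE VbarE (uniform_approximation m_dense XL T0 e0).
move=> n Xe Ve app t tT.
rewrite -ltr_sqr ?nnegrE ?L2norm_ge0 ?(ltW eps0)//.
have e01 : 0 <= e <= 1 by rewrite (ltW e0) ge_min lexx.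
have := stab _ _ _ _ _ _ (galerkin_Km F (m_simplex n)) (Xn_sol n) e01 app t tT.
move=> /le_lt_trans; apply.
apply: (@le_lt_trans _ _ (A * (3 * e))).
  by rewrite ler_wpM2l//; lra.
have ee : e * (4 * (A + 1)) <= eps ^+ 2.
  by rewrite -ler_pdivlMr// ge_min lexx orbT.
have := mulr_ge0 A0 (ltW e0); lra.
Qed.
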